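(* For every constant $\sigma\in\mathbb{Z}_{\ge 0}$ there exists a society (in the full propagation setting) whose areas are of two types such that no non-adaptive spreading strategy with at most $\sigma$ switches (i.e. no $\sigma$-switch spreading strategy) is optimal, where optimal means maximizing the expected number of adopters among all non-adaptive spreading strategies for that society.
   Context: Full propagation setting. A society consists of $n$ areas; area $v$ has a threshold $c_v\in\mathbb{Z}_{>0}$ and an initial acceptance probability $p_v\in[0,1]$. The type of an area $v$ is $\tau(v)=(p_v,c_v)$; areas of the same type have the same threshold and the same initial acceptance probability. A non-adaptive spreading strategy is a permutation $\pi$ of the areas fixed in advance; $\pi(t)$ is the area scheduled at time $t$. When $v=\pi(t)$ is scheduled it makes an irrevocable decision $X_v\in\{1,-1\}$ ($1$ = accept, $-1$ = reject): with $I_{t-1}=\sum_{s<t}X_{\pi(s)}$, if $I_{t-1}\ge c_v$ then $X_v=1$; if $I_{t-1}\le -c_v$ then $X_v=-1$; if $|I_{t-1}|<c_v$ then, independently of the past, $X_v=1$ with probability $p_v$ and $X_v=-1$ with probability $1-p_v$. The number of adopters is the number of areas $v$ with $X_v=1$. A switch of $\pi$ is a position $k\in\{1,\dots,n-1\}$ such that $\tau(\pi(k))\ne\tau(\pi(k+1))$. A $\sigma$-switch spreading strategy is a spreading strategy with at most $\sigma$ switches. *)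

(* Defs.v *)
From HB Require Import structures.
From mathcomp Require Import all_boot all_order all_fingroup all_algebra.
From mathcomp Require Import reals.

Set Implicit Arguments.
Unset Strict Implicit.
Unset Printing Implicit Defensive.

Import Order.TTheory GRing.Theory Num.Theory.
Local Open Scope ring_scope.

Record society (R : realType) := Society {
  areas : nat;
  threshold : 'I_areas -> int;
  accept_init : 'I_areas -> R;
  threshold_gt0 : forall v, 0 < threshold v;
  accept_init01 : forall v, 0 <= accept_init v <= 1
}.

Section FullPropagation.
Variables (R : realType) (S : society R).

Local Notation area := 'I_(areas S).

Definition area_type (v : area) : R * int := (accept_init v, threshold v).

Definition types : seq (R * int) := undup [seq area_type v | v : area].

(* [pi t] is the area scheduled at time [t]; times are numbered from 0. *)
Definition strategy := {perm area}.

(* The position [k] is a switch when it has a successor position [l] whose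
   area is of another type; the last position has no successor. *)
Definition switches (pi : strategy) : {set area} :=
  [set k : area | [exists l : area,
     (l == k.+1 :> nat) && (area_type (pi k) != area_type (pi l))]].

(* An outcome [x] records all the decisions: [x v] holds iff X_v = 1. *)
Definition outcome := {ffun area -> bool}.

Definition decision (x : outcome) (v : area) : int := if x v then 1 else -1.

(* The sum of the decisions taken strictly before time [t]. *)
Definition influence (pi : strategy) (x : outcome) (t : area) : int :=
  \sum_(s : area | (s < t)%N) decision x (pi s).

(* The conditional probability that [v] accepts when it is scheduled while the
   sum of the past decisions is [i]. *)
Definition accept_prob (v : area) (i : int) : R :=
  if threshold v <= i then 1
  else if i <= - threshold v then 0
  else accept_init v.

(* The law of the process on the finite space of outcomes, by the chain rule:
   the product over time of the conditional probabilities of each decision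
   given the past ones. *)
Definition outcome_prob (pi : strategy) (x : outcome) : R :=
  \prod_(t : area)
    let q := accept_prob (pi t) (influence pi x t) in
    if x (pi t) then q else 1 - q.

Definition adopters (x : outcome) : nat := #|[set v | decision x v == 1]|.

Definition expected_adopters (pi : strategy) : R :=
  \sum_(x : outcome) outcome_prob pi x * (adopters x)%:R.

Definition optimal (pi : strategy) : Prop :=
  forall pi' : strategy, expected_adopters pi' <= expected_adopters pi.

End FullPropagation.

(* Main.v *)
(** Take n areas of type A = (3/4, 1) and n of type B = (2/3, 2), and read a
    strategy in blocks of two areas.  After each block the process is either
    back at influence 0 or locked: once the influence is 2 or -2, every later
    area follows it.  From influence 0 the odds of locking at acceptance rather
    than rejection are 3 for AA, 2 for BA, 4 for BB and 3 * 2 = 6 for AB, so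
    (AB)^n is the best word: its final influence has mean at least
    (5/7) 2n - 2, where 5/7 = (6 - 1) / (6 + 1).  A strategy with at most sigma
    switches leaves the pattern ABAB... within its first 2 (sigma + 1) steps,
    hence with a probability bounded below while the process is still at 0, and
    this costs an amount linear in n. *)
Require Import Defs.
From mathcomp Require Import all_boot all_order all_fingroup all_algebra.
From mathcomp Require Import reals.
From mathcomp Require Import zify ring lra.

Set Implicit Arguments.
Unset Strict Implicit.
Unset Printing Implicit Defensive.

Import Order.TTheory GRing.Theory Num.Theory.

(** * The process as a backward recursion along a word of types *)

Section Words.
Local Open Scope ring_scope.
Variable R : realType.
Implicit Types (w : seq (R * int)) (i : int) (phi : int -> R).

Definition accept_type (tau : R * int) i : R :=
  if tau.2 <= i then 1 else if i <= - tau.2 then 0 else tau.1.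

(** Mean of [phi] at the final influence, conditioning on the next decision; a strategy enters only
    through its sequence of types. *)
Fixpoint expect phi w i : R :=
  if w is tau :: w' then
    accept_type tau i * expect phi w' (i + 1)
    + (1 - accept_type tau i) * expect phi w' (i - 1)
  else phi i.

Definition sgb (b : bool) : int := if b then 1 else -1.

Definition cons_ffun n (p : bool * {ffun 'I_n -> bool}) : {ffun 'I_n.+1 -> bool} :=
  [ffun t => oapp p.2 p.1 (unlift ord0 t)].

Lemma cons_ffun_bij n : bijective (@cons_ffun n).
Proof.
exists (fun y : {ffun 'I_n.+1 -> bool} => (y ord0, [ffun t : 'I_n => y (lift ord0 t)])) => [[b y]|y].
  rewrite ffunE unlift_none; congr pair.
  by apply/ffunP => t; rewrite !ffunE liftK.
by apply/ffunP => t; rewrite !ffunE; case: unliftP => [j ->|->] //=; rewrite ffunE.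
Qed.

Lemma sum_cons_ffun n (F : {ffun 'I_n.+1 -> bool} -> R) :
  \sum_y F y = \sum_y F (cons_ffun (true, y)) + \sum_y F (cons_ffun (false, y)).
Proof.
rewrite (reindex _ (onW_bij _ (cons_ffun_bij n))) /=.
by rewrite -(big_bool _ (fun b => \sum_y F (cons_ffun (b, y)))) pair_bigA;
  apply: eq_bigr => -[].
Qed.

(** Links the chain-rule law to the recursion: splitting off the first decision shifts the starting
    influence by [sgb b] for all later factors. *)
Lemma expectE phi n w i : size w = n ->
  \sum_(y : {ffun 'I_n -> bool})
     (\prod_(t < n)
        let q := accept_type (nth (0, 0) w t)
                   (i + \sum_(s < n | (s < t)%N) sgb (y s)) in
        if y t then q else 1 - q) * phi (i + \sum_(s < n) sgb (y s))
  = expect phi w i.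
Proof.
elim: w n i => [|tau w IH] [|n] i //= => [_|[sz_w]].
  rewrite (big_pred1 [ffun=> false]) ?big_ord0 ?mul1r ?addr0 // => y.
  by apply/esym/eqP/ffunP => -[].
rewrite sum_cons_ffun -!(IH n) //.
have cons0 b (y : {ffun 'I_n -> bool}) : cons_ffun (b, y) ord0 = b.
  by rewrite ffunE unlift_none.
have consS b (y : {ffun 'I_n -> bool}) t : cons_ffun (b, y) (lift ord0 t) = y t.
  by rewrite ffunE liftK.
have factor b : \sum_(y : {ffun 'I_n -> bool})
     (\prod_(t < n.+1)
        let q := accept_type (nth (0, 0) (tau :: w) t)
                   (i + \sum_(s < n.+1 | (s < t)%N) sgb (cons_ffun (b, y) s)) in
        if cons_ffun (b, y) t then q else 1 - q)
     * phi (i + \sum_(s < n.+1) sgb (cons_ffun (b, y) s))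
  = (if b then accept_type tau i else 1 - accept_type tau i) *
    \sum_(y : {ffun 'I_n -> bool})
     (\prod_(t < n)
        let q := accept_type (nth (0, 0) w t)
                   (i + sgb b + \sum_(s < n | (s < t)%N) sgb (y s)) in
        if y t then q else 1 - q) * phi (i + sgb b + \sum_(s < n) sgb (y s)).
  rewrite mulr_sumr; apply: eq_bigr => y _.
  rewrite mulrA; congr (_ * phi _); last first.
    rewrite big_ord_recl cons0 addrA; congr (_ + _).
    by apply: eq_bigr => s _; rewrite consS.
  rewrite big_ord_recl /= cons0 big_pred0 // addr0; congr (_ * _).
  apply: eq_bigr => t _; rewrite consS.
  rewrite big_mkcond big_ord_recl /= cons0 addrA.
  rewrite [in RHS]big_mkcond /=.
  by under eq_bigr do rewrite consS.
by rewrite !factor.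
Qed.

Lemma expect_affine (c d : R) phi w i :
  expect (fun j => c + d * phi j) w i = c + d * expect phi w i.
Proof. by elim: w i => //= tau w IH i; rewrite !IH; ring. Qed.

(** Locking: a forced acceptance raises the influence, so every threshold stays reached. *)
Lemma expect_accept phi w i : all (fun tau => tau.2 <= i) w ->
  expect phi w i = phi (i + (size w)%:Z).
Proof.
elim: w i => [|tau w IH] i /=; first by rewrite addr0.
case/andP=> le_tau le_w; rewrite /accept_type le_tau subrr mul0r addr0 mul1r.
rewrite IH; first by congr phi; lia.
by apply: sub_all le_w => c /=; lia.
Qed.

Lemma expect_reject phi w i : all (fun tau => (0 < tau.2) && (i <= - tau.2)) w ->
  expect phi w i = phi (i - (size w)%:Z).
Proof.
elim: w i => [|tau w IH] i /=; first by rewrite subr0.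
case/andP=> /andP[tau_gt0 le_tau] le_w.
have /negbTE tauF : ~~ (tau.2 <= i) by lia.
rewrite /accept_type tauF le_tau mul0r add0r subr0 mul1r.
rewrite IH; first by congr phi; lia.
by apply: sub_all le_w => c /=; lia.
Qed.

End Words.

(** * From expected adopters to mean final influence *)

Section Society.
Local Open Scope ring_scope.
Variables (R : realType) (S : society R).
Implicit Types (pi : strategy S).

Definition type_word pi : seq (R * int) := [seq area_type (pi t) | t : 'I_(areas S)].

Lemma adoptersE (x : outcome S) :
  (adopters x)%:R =
  (areas S)%:R / 2 + 2^-1 * (\sum_v decision x v)%:~R :> R.
Proof.
have -> : (areas S)%:R = \sum_(v < areas S) 1 :> R by rewrite sumr_const card_ord.
rewrite /adopters -sum1_card natr_sum big_mkcond /= mulr_suml raddf_sum mulr_sumr -big_split /=.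
apply: eq_bigr => v _; rewrite inE /decision.
by case: (x v) => /=; lra.
Qed.

Lemma expected_adoptersE pi :
  expected_adopters pi =
  (areas S)%:R / 2 + 2^-1 * expect intr (type_word pi) 0.
Proof.
rewrite -expect_affine -(@expectE _ _ (areas S)); last by rewrite size_map -cardE card_ord.
(* Outcomes are indexed by area, [expectE] by time; [h] translates. *)
pose h (y : {ffun 'I_(areas S) -> bool}) : outcome S := [ffun v => y (pi^-1%g v)].
have hE y t : h y (pi t) = y t by rewrite ffunE permK.
have h_bij : bijective h.
  exists (fun x : outcome S => [ffun t => x (pi t)]) => z; apply/ffunP => t.
    by rewrite !ffunE permK.
  by rewrite !ffunE permKV.
rewrite /expected_adopters (reindex _ (onW_bij _ h_bij)) /=.
apply: eq_bigr => y _; rewrite adoptersE add0r; congr (_ * (_ + _ * _%:~R)); last first.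
  rewrite (reindex_inj (@perm_inj _ pi)); apply: eq_bigr => t _.
  by rewrite /decision hE.
apply: eq_bigr => t _; rewrite /= hE add0r.
rewrite (nth_map t) ?size_enum_ord // nth_ord_enum.
rewrite (_ : influence pi (h y) t = \sum_(s < areas S | (s < t)%N) sgb (y s)) //.
by apply: eq_bigr => s _; rewrite /decision hE.
Qed.

End Society.

(** * Bounds for words in two letters, and the society realizing them *)

Section TwoTypes.
Local Open Scope ring_scope.
Variable R : realType.
Implicit Types w : seq bool.

Definition two_type (b : bool) : R * int := if b then (2 / 3, 2) else (3 / 4, 1).

(* The mean final influence when the areas with letters [w] are scheduled from
   influence 0; [true] stands for B. *)
Definition drift w : R := expect intr (map two_type w) 0.

Definition alternating k : seq bool := mkseq odd k.*2.

Lemma alternatingS k : alternating k.+1 = [:: false, true & alternating k].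
Proof.
rewrite /alternating /mkseq doubleS /=; congr [:: _, _ & _].
rewrite (iotaDl 2 0) -map_comp; apply: eq_map => t /=; lia.
Qed.

Lemma natr2 n : n.+2%:R = 2 + n%:R :> R.
Proof. by rewrite -natrD. Qed.

Lemma drift_accept w : expect intr (map two_type w) 2 = 2 + (size w)%:R :> R.
Proof.
rewrite expect_accept ?size_map ?rmorphD //.
by rewrite all_map; apply/allP => -[].
Qed.

Lemma drift_reject w : expect intr (map two_type w) (-2) = - (2 + (size w)%:R) :> R.
Proof.
rewrite expect_reject ?size_map -?opprD ?rmorphN ?rmorphD //.
by rewrite all_map; apply/allP => -[].
Qed.

(** The coefficient of [2 + size w] is the probability of locking at 2 minus that of locking at -2;
    the coefficient of [drift w] is the probability of returning to 0, which is zero when the second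
    letter is A. *)
Lemma drift_cons2 b c w : drift [:: b, c & w] =
  match b, c with
  | false, false => 1 / 2 * (2 + (size w)%:R)
  | false, true => 5 / 12 * (2 + (size w)%:R) + 5 / 12 * drift w
  | true, false => 1 / 3 * (2 + (size w)%:R)
  | true, true => 1 / 3 * (2 + (size w)%:R) + 4 / 9 * drift w
  end.
Proof.
rewrite /drift /= !add0r subrr addNr.
rewrite -[1 + 1]/(2 : int) -[-1 - 1]/(-2 : int) drift_accept drift_reject.
by case: b; case: c; rewrite /accept_type /=; field.
Qed.

Lemma word2_ind (P : seq bool -> Prop) : P [::] ->
  (forall b c w, ~~ odd (size w) -> P w -> P [:: b, c & w]) ->
  forall w, ~~ odd (size w) -> P w.
Proof.
move=> P0 PS w; have [m] := ubnP (size w); elim: m w => // m IH [|b [|c w]] //=.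
by move=> lt_m; rewrite negbK => ev; apply: PS => //; apply: IH => //; lia.
Qed.

(** The rate 5/7 is the fixed point of x = 5/12 + 5/12 x, the recursion for AB; the other blocks
    give smaller rates. *)
Lemma drift_le w : ~~ odd (size w) -> drift w <= 5 / 7 * (size w)%:R.
Proof.
elim/word2_ind => [|b c {}w _ IH]; first by rewrite /drift mulr0.
have := ler0n R (size w).
by rewrite drift_cons2 /= (natr2 (size w)); case: b; case: c; lra.
Qed.

Lemma drift_alternating_ge n : 5 / 7 * n.*2%:R - 2 <= drift (alternating n).
Proof.
elim: n => [|n IH]; first by rewrite /drift /= mulr0; lra.
rewrite alternatingS drift_cons2 size_mkseq doubleS (natr2 n.*2).
by have := ler0n R n.*2; lra.
Qed.

Lemma drift_not_prefix k w : ~~ odd (size w) -> ~~ prefix (alternating k) w ->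
  drift w <= (5 / 7 - (5 / 12) ^+ k / 20) * (size w)%:R.
Proof.
move=> ev; elim/word2_ind: ev k => {w} [|b c w ev IH] [|k].
- by rewrite prefix0s.
- by rewrite /drift mulr0.
- by rewrite prefix0s.
rewrite alternatingS drift_cons2 /= (natr2 (size w)).
have m0 := ler0n R (size w); have Fle := drift_le ev.
set e : R := (5 / 12) ^+ k.
have e0 : 0 <= e by rewrite exprn_ge0 //; lra.
have e1 : e <= 1 by rewrite exprn_ile1 //; lra.
have em1 : e * (size w)%:R <= (size w)%:R by rewrite ler_piMl.
(* A block other than AB loses at least 5/7 - 41/63 = 4/63 > 1/20 per area, BB being the closest. A
   block AB passes the loss of the rest on with factor 5/12. *)
rewrite exprS -/e; case: b; case: c => /=; try (move=> _; nra).
by move=> /IH; rewrite -/e; nra.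
Qed.

Lemma two_type_gt0 (b : bool) : 0 < (two_type b).2.
Proof. by case: b. Qed.

Lemma two_type01 (b : bool) : 0 <= (two_type b).1 <= 1.
Proof. by case: b => /=; lra. Qed.

(** Types follow parity, so the identity permutation schedules ABAB... *)
Definition two_society n : society R :=
  @Society R n.*2 (fun v => (two_type (odd v)).2) (fun v => (two_type (odd v)).1)
    (fun v => two_type_gt0 (odd v)) (fun v => two_type01 (odd v)).

Lemma area_type_two n (v : 'I_n.*2) :
  area_type (v : 'I_(areas (two_society n))) = two_type (odd v).
Proof. by rewrite /area_type /=; case: two_type. Qed.

Lemma two_type_inj : injective two_type.
Proof. by case=> [] [] // [] _ /eqP. Qed.

Lemma size_types n : (0 < n)%N -> size (types (two_society n)) = 2%N.
Proof.
move=> n_gt0; rewrite -[RHS]/(size [:: two_type false; two_type true]).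
apply/perm_size/uniq_perm; first exact: undup_uniq.
  by rewrite cons_uniq inE (inj_eq two_type_inj).
move=> tau; rewrite mem_undup !inE; apply/mapP/idP => [[v _ ->]|].
  by rewrite area_type_two !(inj_eq two_type_inj); case: odd.
have lt0 : (0 < n.*2)%N by lia.
have lt1 : (1 < n.*2)%N by lia.
case/orP=> /eqP->; [exists (Ordinal lt0)|exists (Ordinal lt1)];
  by rewrite ?area_type_two ?mem_enum.
Qed.

Definition parity_word n (pi : strategy (two_society n)) : seq bool :=
  [seq odd (pi t) | t : 'I_n.*2].

Lemma size_parity_word n (pi : strategy (two_society n)) :
  size (parity_word pi) = n.*2.
Proof. by rewrite size_map -cardE card_ord. Qed.

Lemma expected_adopters_drift n (pi : strategy (two_society n)) :
  expected_adopters pi = n.*2%:R / 2 + 2^-1 * drift (parity_word pi).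
Proof.
rewrite expected_adoptersE /drift; congr (_ + _ * expect _ _ _).
by rewrite -map_comp; apply: eq_map => t; rewrite /= area_type_two.
Qed.

Lemma parity_word1 n : parity_word (1%g : strategy (two_society n)) = alternating n.
Proof.
rewrite /alternating /mkseq -val_enum_ord -map_comp.
by apply: eq_map => t; rewrite /= perm1.
Qed.

Lemma alternating_switches n k (pi : strategy (two_society n)) :
  prefix (alternating k.+1) (parity_word pi) -> (k < #|switches pi|)%N.
Proof.
move=> pre.
have le_k : (k.+1.*2 <= n.*2)%N.
  by have := size_prefix pre; rewrite size_mkseq size_parity_word.
have pi_odd (t : 'I_n.*2) : (t < k.+1.*2)%N -> odd (pi t) = odd t.
  move=> lt_t; transitivity (nth false (parity_word pi) t).
    by rewrite (nth_map t) ?size_enum_ord // nth_ord_enum.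
  case/prefixP: pre => s ->.
  by rewrite nth_cat size_mkseq lt_t nth_mkseq.
(* The first [k.+1] positions suffice as switches, and each has its successor inside the prefix. *)
have le_n : (k.+1 <= n.*2)%N by lia.
have widen_inj : injective (widen_ord le_n) by move=> s t [] /val_inj.
rewrite -[leqLHS]card_ord -(card_imset _ widen_inj).
apply/subset_leq_card/subsetP => _ /imsetP[t _ ->]; rewrite inE.
have lt_t := ltn_ord t.
have lt_t1 : (t.+1 < n.*2)%N by lia.
apply/existsP; exists (Ordinal lt_t1); rewrite eqxx /= !area_type_two.
by rewrite (inj_eq two_type_inj) !pi_odd /=; lia.
Qed.

End TwoTypes.

Theorem theorem2 (R : realType) (sigma : nat) :
  exists S : society R,
    size (types S) = 2 /\
    forall pi : strategy S, #|switches pi| <= sigma -> ~ optimal pi.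
Proof.
pose e : R := ((5 / 12) ^+ sigma.+1)%R.
have e_gt0 : (0 < e)%R by rewrite exprn_gt0 //; lra.
(* The loss [e / 20] on each of 2n areas must exceed the deficit 2 of the alternating word, that is
   [n * e > 20]. *)
pose n := Num.bound (20 / e)%R.
have lt_n : (20 / e < n%:R)%R.
  by apply: le_lt_trans (archi_boundP _); rewrite ?lexx // divr_ge0 // ltW.
exists (two_society R n); split.
  by apply: size_types; rewrite -(ltr0n R); apply: lt_trans lt_n; rewrite divr_gt0.
(* The identity is the competitor that beats [pi]. *)
move=> pi le_sigma /(_ 1%g).
rewrite !expected_adopters_drift parity_word1.
have := drift_alternating_ge R n.
have := @drift_not_prefix R sigma.+1 (parity_word pi).
rewrite size_parity_word odd_double -/e => /(_ isT).
have not_alternating : ~~ prefix (alternating sigma.+1) (parity_word pi).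
  by apply/negP => /alternating_switches; lia.
move=> /(_ not_alternating).
have : (20 < n%:R * e)%R by rewrite -ltr_pdivrMr.
rewrite -muln2 natrM; nra.
Qed.
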